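(* Let $N,W,L,k,P\ge 1$ be integers with $k$ dividing both $W$ and $L$. Let $G=\mathbb{Z}_W\times\mathbb{Z}_L$ act on feature maps in $(\mathbb{R}^{W\times L})^N$ ($N$ filters) by cyclically shifting each of the $N$ channels simultaneously; denote this representation by $\pi$. Let $\bm{P} : (\mathbb{R}^{W\times L})^N\to(\mathbb{R}^{(W/k)\times(L/k)})^N$ be local average pooling over non-overlapping $k\times k$ windows, applied to each channel. Let $\rho$ denote the representation of the subgroup $H = k\mathbb{Z}_W\times k\mathbb{Z}_L\cong\mathbb{Z}_{W/k}\times\mathbb{Z}_{L/k}$ by cyclic shifts of each channel of $(\mathbb{R}^{(W/k)\times(L/k)})^N$. Let $r^1,\dots,r^P\in(\mathbb{R}^{W\times L})^N$ be such that the points $\langle\rho(h)\rangle_{h\in H}\,\bm{P} r^\mu$, $\mu\in\{1,\dots,P\}$, are in general position in the range of $\langle\rho(h)\rangle_{h\in H}$. Then the fraction of the $2^P$ dichotomies $(y^\mu)_\mu\in\{-1,+1\}^P$ that are linearly separable after pooling, i.e. for which there exists a vector $w\in(\mathbb{R}^{(W/k)\times(L/k)})^N$ with $$y^\mu\, w^\top \bm{P}\,\pi(g)\, r^\mu > 0\quad\text{for all } g\in G,\ \mu\in\{1,\dots,P\},$$ is equal to $f(P,N)$.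
   Context: $\mathbb{Z}_m$ is the cyclic group of integers modulo $m$. The cyclic shift representation of $\mathbb{Z}_W\times\mathbb{Z}_L$ on $\mathbb{R}^{W\times L}$ sends $(s,t)$ to the operator that cyclically shifts the rows of a matrix by $s$ and its columns by $t$ (periodic boundary). The element $(nk,mk)\in H$ acts under $\rho$ by cyclically shifting by $n$ and $m$. Average pooling of a channel $a\in\mathbb{R}^{W\times L}$ (indices from $0$) gives the matrix with $(i,j)$ entry $\frac{1}{k^2}\sum_{i'=ik}^{(i+1)k-1}\sum_{j'=jk}^{(j+1)k-1}a_{i'j'}$. $\langle\rho(h)\rangle_{h\in H}=\frac{1}{|H|}\sum_{h\in H}\rho(h)$. $w^\top v$ denotes the standard inner product of the flattened vectors. A family of points is in general position in a vector space of dimension $n$ if every subfamily of $n$ or fewer of the points is linearly independent. The function $f$ is $f(P,n)=2^{1-P}\sum_{j=0}^{n-1}\binom{P-1}{j}$ with $\binom{a}{b}=0$ for $b>a$. *)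

(* Defs.v *)
From HB Require Import structures.
From mathcomp Require Import all_boot all_order all_algebra.
From mathcomp Require Import boolp reals.

Set Implicit Arguments.
Unset Strict Implicit.
Unset Printing Implicit Defensive.

Import Order.TTheory GRing.Theory Num.Theory.

Local Open Scope ring_scope.

(* The cyclic group of integers modulo m, for m >= 1 ('Z_m is wrong at m = 1).
   For m >= 1, the type 'I_m.-1.+1 is 'I_m with addition modulo m. *)
Notation cyc m := 'I_m.-1.+1.

Notation torus W L := (cyc W * cyc L)%type.

Notation fmaps R N m n := {ffun 'I_N -> 'M[R]_(m, n)}.

Section Operators.
Variables (R : realType) (N : nat).

(* Entry (i, j) of channel c moves to (i + s, j + t), modulo (m, n). *)
Definition cshift_fun m n (s t : nat) (a : fmaps R N m n) : fmaps R N m n :=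
  [ffun c => \matrix_(i, j) a c (iter s (@ord_pred m) i)
                                (iter t (@ord_pred n) j)].

Fact cshift_fun_is_linear m n s t : linear (@cshift_fun m n s t).
Proof.
by move=> x a b; apply/ffunP=> c; apply/matrixP=> i j; rewrite !(ffunE, mxE).
Qed.

HB.instance Definition _ m n s t := GRing.isLinear.Build R
  (fmaps R N m n) (fmaps R N m n) *:%R (@cshift_fun m n s t)
  (@cshift_fun_is_linear m n s t).

Definition cshift m n (s t : nat) : 'End(fmaps R N m n) :=
  linfun (cshift_fun s t).

Definition piG W L (g : torus W L) : 'End(fmaps R N W L) := cshift W L g.1 g.2.

Definition pool_fun k W L (a : fmaps R N W L) :
    fmaps R N (W %/ k) (L %/ k) :=
  [ffun c => \matrix_(i, j) ((k%:R ^+ 2)^-1 *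
     \sum_(i' < W | (i * k <= i' < i.+1 * k)%N)
       \sum_(j' < L | (j * k <= j' < j.+1 * k)%N) a c i' j')].

Fact pool_fun_is_linear k W L : linear (@pool_fun k W L).
Proof.
move=> x a b; apply/ffunP=> c; apply/matrixP=> i j; rewrite !(ffunE, mxE).
rewrite mulrCA -mulrDr; congr (_ * _).
rewrite mulr_sumr -big_split; apply: eq_bigr => i' _ /=.
rewrite mulr_sumr -big_split; apply: eq_bigr => j' _ /=.
by rewrite !(ffunE, mxE).
Qed.

HB.instance Definition _ k W L := GRing.isLinear.Build R
  (fmaps R N W L) (fmaps R N (W %/ k) (L %/ k)) *:%R (@pool_fun k W L)
  (@pool_fun_is_linear k W L).

Definition pool k W L : 'Hom(fmaps R N W L, fmaps R N (W %/ k) (L %/ k)) :=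
  linfun (@pool_fun k W L).

(* The subgroup k Z_W x k Z_L. *)
Definition subH k W L : {set torus W L} := [set g *+ k | g : torus W L].

(* Only meaningful on subH k W L, where (n k, m k) acts as the shift by (n, m);
   see rhoHE. *)
Definition rhoH k W L (h : torus W L) : 'End(fmaps R N (W %/ k) (L %/ k)) :=
  cshift (W %/ k) (L %/ k) (h.1 %/ k) (h.2 %/ k).

Definition avg_rhoH k W L : 'End(fmaps R N (W %/ k) (L %/ k)) :=
  #|subH k W L|%:R^-1 *: \sum_(h in subH k W L) rhoH k h.

Definition inner m n (w v : fmaps R N m n) : R :=
  \sum_(c < N) \sum_(i < m) \sum_(j < n) w c i j * v c i j.

Lemma iter_ord_predE m s (i : 'I_m) :
  (iter s (@ord_pred m) i + s = i %[mod m])%N.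
Proof.
elim: s => [|s IHs]; first by rewrite addn0.
rewrite addnS iterS /= -addnS modnDml.
have m_gt0 : (0 < m)%N by exact: leq_ltn_trans (ltn_ord i).
set u := iter _ _ _ in IHs *.
have -> : ((u + m).-1 + s.+1 = u + s + m)%N.
  by rewrite addnS -addSn prednK ?addn_gt0 ?m_gt0 ?orbT // addnAC.
by rewrite modnDr.
Qed.

Lemma eq_cshift m n s s' t t' :
  (s = s' %[mod m])%N -> (t = t' %[mod n])%N -> cshift m n s t = cshift m n s' t'.
Proof.
have aux p (i : 'I_p) u u' : (u = u' %[mod p])%N ->
    iter u (@ord_pred p) i = iter u' (@ord_pred p) i.
  move=> uu'; apply: val_inj => /=.
  rewrite -[LHS](modn_small (ltn_ord _)) -[RHS](modn_small (ltn_ord _)); apply/eqP.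
  rewrite -(eqn_modDr u) iter_ord_predE -(iter_ord_predE u' i) eqn_modDl.
  by rewrite uu'.
move=> ss' tt'; apply/lfunP=> a; rewrite !lfunE /=.
apply/ffunP=> c; apply/matrixP=> i j; rewrite !(ffunE, mxE).
by rewrite (aux _ i _ _ ss') (aux _ j _ _ tt').
Qed.

Lemma cshiftD m n s s' t t' :
  cshift m n (s + s') (t + t') = (cshift m n s t \o cshift m n s' t')%VF.
Proof.
apply/lfunP=> a; rewrite comp_lfunE !lfunE /=.
apply/ffunP=> c; apply/matrixP=> i j.
by rewrite !(ffunE, mxE) addnC (addnC t) !iterD.
Qed.

Lemma piGD W L (g h : torus W L) :
  (0 < W)%N -> (0 < L)%N -> piG (g + h) = (piG g \o piG h)%VF.
Proof.
move=> W_gt0 L_gt0; rewrite -cshiftD; case: W L g h W_gt0 L_gt0 => [|W] [|L] g h // _ _.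
by apply: eq_cshift; rewrite /= modn_mod.
Qed.

Lemma rhoHE k W L (g : torus W L) : (0 < k)%N -> (0 < W)%N -> (0 < L)%N ->
  (k %| W)%N -> (k %| L)%N -> rhoH k (g *+ k) = cshift (W %/ k) (L %/ k) g.1 g.2.
Proof.
have aux p (x : cyc p) : (0 < k)%N -> (0 < p)%N -> (k %| p)%N ->
    ((x *+ k)%R %/ k = x %[mod p %/ k])%N.
  case: p x => // p x k0 _ /dvdnP[q Eq]; rewrite Zp_mulrn /=.
  by move: (nat_of_ord x) => y; rewrite Eq -muln_modl !mulnK // modn_mod.
move=> k0 W0 L0 kW kL; rewrite pairMnE; apply: eq_cshift; exact: aux.
Qed.

End Operators.

Definition general_position (R : realType) (V : vectType R) (U : {vspace V})
    (p : nat) (x : 'I_p -> V) : Prop :=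
  (forall mu, x mu \in U) /\
  (forall J : {set 'I_p}, (#|J| <= \dim U)%N -> free [seq x mu | mu in J]).

(* A dichotomy is encoded by its sign bits: the label y^mu is (-1)^+(y mu). *)
Definition pool_separable (R : realType) (N k W L p : nat)
    (r : 'I_p -> fmaps R N W L) (y : {ffun 'I_p -> bool}) : Prop :=
  exists w : fmaps R N (W %/ k) (L %/ k),
    forall (g : torus W L) (mu : 'I_p),
      0 < (-1) ^+ (y mu) * inner w (pool R N k W L (piG R N g (r mu))).

Definition fraction_pool_separable (R : realType) (N k W L p : nat)
    (r : 'I_p -> fmaps R N W L) : R :=
  #|[set y : {ffun 'I_p -> bool} | `[< pool_separable k r y >]]|%:R / 2 ^+ p.

Definition cover_f (R : realType) (p n : nat) : R :=
  2 ^ (1 - p%:Z) * \sum_(0 <= j < n) 'C(p - 1, j)%:R.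

(* Main.v *)
Require Import Defs.
From HB Require Import structures.
From mathcomp Require Import all_boot all_order all_algebra.
From mathcomp Require Import boolp reals.
From mathcomp Require Import ring lra.

Set Implicit Arguments.
Unset Strict Implicit.
Unset Printing Implicit Defensive.

Import Order.TTheory GRing.Theory Num.Theory.

Local Open Scope ring_scope.

(* Averaging over H turns a channel into a constant one, and a channelwise
   constant w pairs with P pi(g) r^mu only through the channel sums of r^mu,
   which neither pooling (up to scale) nor shifts change.  So a dichotomy is
   separable after pooling iff the averaged points are separated by some w in
   the N-dimensional range of the averaging operator, and Cover's function
   counting theorem applies.  The latter is stated for linear functionals on a
   subspace U, so that passing to the hyperplane orthogonal to a point only
   replaces U by its intersection with a kernel. *)

(** The step is a minimum of finitely many positive ratios. The [1 +] in the denominators avoids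
    division by zero and makes the final inequality strict. *)
Lemma small_perturbation (R : realFieldType) (T : finType) (S : {set T})
    (f g : T -> R) : (forall i, i \in S -> 0 < f i) ->
  exists2 e, 0 < e & forall i, i \in S -> 0 < f i + e * g i.
Proof.
move=> f_gt0; pose q i := f i / (1 + `|g i|).
have dg i : 0 < 1 + `|g i| by rewrite ltr_pwDl.
exists (\big[Num.min/1]_(i in S) q i).
  by apply: lt_bigmin => // i iS; rewrite divr_gt0 ?f_gt0.
set e := \big[_/_]_(_ in _) _ => i iS.
have e_gt0 : 0 < e by apply: lt_bigmin => // j jS; rewrite divr_gt0 ?f_gt0.
have : e <= q i by exact: bigmin_le_cond.
rewrite ler_pdivlMr // mulrDr mulr1 => le_f.
have : - (e * g i) <= e * `|g i| by rewrite -mulrN ler_pM2l // -normrN ler_norm.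
by lra.
Qed.

(** * Function counting for linear functionals on a subspace *)

Section Cover.
Variables (R : realFieldType) (V : vectType R) (T : finType).
Variable phi : T -> 'Hom(V, R^o).
Implicit Types (U : {vspace V}) (S A J : {set T}).

(* [A] is the set of points labelled [-1] in a dichotomy of [S]. *)
Definition separates S A (w : V) :=
  forall i, i \in S -> 0 < (-1) ^+ (i \in A) * (phi i w : R).

Definition separable U S A := exists2 w, w \in U & separates S A w.

(** Linear independence of the restrictions to [U], tested on vectors so that [U] can shrink while
    [phi] stays fixed. *)
Definition independent_on U J := forall x : T -> R,
  (forall u, u \in U -> \sum_(j in J) x j * (phi j u : R) = 0) ->
  forall j, j \in J -> x j = 0.

Definition in_general_position U S := forall J,
  J \subset S -> (#|J| <= \dim U)%N -> independent_on U J.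

Lemma separates_perturbation S A w u : separates S A w ->
  exists2 e, 0 < e & separates S A (w + e *: u).
Proof.
move=> sep_w.
have [e e_gt0 e_sep] :=
  small_perturbation (fun i => (-1) ^+ (i \in A) * (phi i u : R)) sep_w.
exists e => // i /e_sep; congr (0 < _).
by rewrite linearD linearZ /= mulrDr [X in _ + X]mulrCA.
Qed.

Lemma separates_comb S A w w' x y : 0 < x -> 0 < y ->
  separates S A w -> separates S A w' -> separates S A (x *: w + y *: w').
Proof.
move=> x0 y0 sep_w sep_w' i iS; rewrite linearD !linearZ /= mulrDr.
by rewrite addr_gt0 // [X in _ < X]mulrCA mulr_gt0 ?sep_w ?sep_w'.
Qed.

Lemma separatesU1 S (A B : {set T}) a w :
    (forall i, i \in S -> (i \in B) = (i \in A)) ->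
  separates (a |: S) B w <->
  0 < (-1) ^+ (a \in B) * (phi a w : R) /\ separates S A w.
Proof.
move=> eqBA; split=> [sep_w|[sep_a sep_w] i].
  split=> [|i iS]; first by apply: sep_w; rewrite setU11.
  by rewrite -eqBA // sep_w // setU1r.
by case/setU1P=> [-> //|iS]; rewrite eqBA // sep_w.
Qed.

(* Both labels of a new point [a] extend a dichotomy exactly when the dichotomy
   is separated by some [w] with [phi a w = 0]: perturb in one direction,
   take a convex combination in the other. *)
Lemma separable_extensions U S A a u : a \notin S -> A \subset S ->
    u \in U -> phi a u != 0 ->
  (`[< separable U (a |: S) A >] + `[< separable U (a |: S) (a |: A) >] =
   `[< separable U S A >] + `[< separable (U :&: lker (phi a)) S A >])%N.
Proof.
move=> aS AS uU phi_u; set U0 := (U :&: _)%VS.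
have aA : a \notin A by apply: contra aS; apply: (subsetP AS).
have posE : separable U (a |: S) A <->
    exists2 w, w \in U & 0 < (phi a w : R) /\ separates S A w.
  by split=> -[w wU sw]; exists w => //; move: sw;
     rewrite (@separatesU1 S A) // (negbTE aA) mul1r.
have negE : separable U (a |: S) (a |: A) <->
    exists2 w, w \in U & (phi a w : R) < 0 /\ separates S A w.
  have eqA i : i \in S -> (i \in a |: A) = (i \in A).
    by move=> iS; rewrite in_setU1; case: eqP iS => // ->; rewrite (negbTE aS).
  by split=> -[w wU sw]; exists w => //; move: sw;
     rewrite (@separatesU1 S A) // setU11 mulN1r oppr_gt0.
have perturb w v : w \in U0 -> separates S A w -> v \in U -> exists2 e, 0 < e &
    exists2 w', w' \in U & (phi a w' : R) = e * phi a v /\ separates S A w'.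
  rewrite memv_cap memv_ker => /andP[wU /eqP w0] sep_w vU.
  have [e e_gt0 sep_e] := separates_perturbation v sep_w; exists e => //.
  exists (w + e *: v); first by rewrite memvD ?memvZ.
  by rewrite linearD linearZ /= w0 add0r.
have pos_or_neg w : w \in U0 -> separates S A w ->
    separable U (a |: S) A /\ separable U (a |: S) (a |: A).
  move=> wU0 sep_w.
  (* Moving along [phi a u *: u] changes [phi a] by a positive multiple of a square, whatever the
     sign of [phi a u]. *)
  have sq_gt0 : 0 < (phi a u : R) ^+ 2 by rewrite exprn_even_gt0.
  split; [apply/posE | apply/negE].
    have [e e_gt0 [w' w'U [phi_w' sep_w']]] :=
      perturb w ((phi a u : R) *: u) wU0 sep_w (memvZ _ uU).
    by exists w'; rewrite ?phi_w' // linearZ /= -[_ *: _]expr2 mulr_gt0.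
  have [e e_gt0 [w' w'U [phi_w' sep_w']]] :=
    perturb w (- (phi a u : R) *: u) wU0 sep_w (memvZ _ uU).
  exists w'; rewrite ?phi_w' // linearZ /= pmulr_rlt0 //.
  by rewrite [_ *: _]mulNr -expr2 oppr_lt0.
have sepE : separable U S A <->
    separable U (a |: S) A \/ separable U (a |: S) (a |: A).
  split=> [[w wU sep_w]|]; last first.
    by case=> [/posE|/negE] [w wU [_ sep_w]]; exists w.
  case: (ltrgtP (phi a w : R) 0) => [w_lt0|w_gt0|/eqP w0].
  - by right; apply/negE; exists w.
  - by left; apply/posE; exists w.
  by left; apply: (proj1 (pos_or_neg w _ sep_w)); rewrite memv_cap wU memv_ker.
have sep0E : separable U0 S A <->
    separable U (a |: S) A /\ separable U (a |: S) (a |: A).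
  split=> [[w wU0]|[/posE[v vU [v_gt0 sep_v]] /negE[w wU [w_lt0 sep_w]]]].
    exact: pos_or_neg.
  (* Both coefficients are positive, and they make the values of [phi a] cancel. *)
  exists (- (phi a w : R) *: v + (phi a v : R) *: w); last first.
    by apply: separates_comb; rewrite ?oppr_gt0.
  rewrite memv_cap memvD ?memvZ //= memv_ker linearD !linearZ /=.
  by apply/eqP; rewrite [X in X + _]mulNr [X in _ + X]mulrC addNr.
have -> : `[< separable U S A >] =
    `[< separable U (a |: S) A >] || `[< separable U (a |: S) (a |: A) >].
  by rewrite -asbool_or; apply: asbool_equiv_eq.
have -> : `[< separable U0 S A >] =
    `[< separable U (a |: S) A >] && `[< separable U (a |: S) (a |: A) >].
  by rewrite -asbool_and; apply: asbool_equiv_eq.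
by do 2!case: asbool.
Qed.

(** Rank-nullity: [phi a] maps [U] onto a nonzero subspace of a line. *)
Lemma dim_cap_lker U a u : u \in U -> phi a u != 0 ->
  (\dim (U :&: lker (phi a))).+1 = \dim U.
Proof.
move=> uU phi_u; rewrite -(limg_ker_dim (phi a) U) -addn1; congr addn.
apply/eqP; rewrite eqn_leq; apply/andP; split; last first.
  by have := dimvS (subvf (phi a @: U)); rewrite dimvf.
rewrite lt0n dimv_eq0; apply: contra phi_u => /eqP U0.
by rewrite -memv0 -U0 memv_img.
Qed.

(** Otherwise the singleton [[set a]] would carry a nontrivial relation on [U]. *)
Lemma general_position_exists U S a : in_general_position U S -> a \in S ->
  (0 < \dim U)%N -> exists2 u, u \in U & phi a u != 0.
Proof.
move=> gpU aS U_gt0; apply: contrapT => no_u.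
have /(_ (fun=> 1)) phi_a : independent_on U [set a].
  by apply: gpU; rewrite ?sub1set ?cards1.
suff /eqP : 1 = 0 :> R by rewrite oner_eq0.
apply: (phi_a _ a); last by rewrite set11.
move=> u uU; rewrite big_set1 mul1r; apply/eqP.
by apply: contrapT => /negP phi_u; apply: no_u; exists u.
Qed.

(* A combination vanishing on [ker (phi a)] is a multiple of [phi a] on [U]. *)
Lemma general_position_cap U S a u : a \notin S ->
    in_general_position U (a |: S) -> u \in U -> phi a u != 0 ->
  in_general_position (U :&: lker (phi a)) S.
Proof.
move=> aS gpU uU phi_u J JS leJ x x0 j jJ.
have aJ : a \notin J by apply: contra aS; apply: (subsetP JS).
pose s v : R := \sum_(i in J) x i * (phi i v : R).
(* The coefficient of [a] makes the extended combination vanish at [u]; every [v] in [U] is a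
   multiple of [u] plus a vector of the kernel. *)
pose y i := if i == a then - (s u / (phi a u : R)) else x i.
have yJ i : i \in J -> y i = x i.
  by rewrite /y; case: eqP => // ->; rewrite (negbTE aJ).
rewrite -yJ //; apply: (gpU (a |: J)) (setU1r _ jJ); first exact: setUS.
  by rewrite cardsU1 aJ -(dim_cap_lker uU phi_u).
move=> v vU; rewrite big_setU1 //= {1}/y eqxx.
under eq_bigr => i iJ do rewrite yJ //.
pose t := (phi a v : R) / (phi a u : R).
have vtu : v - t *: u \in (U :&: lker (phi a))%VS.
  rewrite memv_cap memvB ?memvZ //= memv_ker linearB linearZ /=.
  by rewrite [t *: _]divfK // subrr.
have -> : \sum_(i in J) x i * (phi i v : R) = s (v - t *: u) + t * s u.
  rewrite /s mulr_sumr -big_split; apply: eq_bigr => i _ /=.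
  have -> : phi i (v - t *: u) = (phi i v : R) - t * (phi i u : R) :> R.
    by rewrite linearB linearZ.
  by ring.
rewrite [s (v - _)]x0 // add0r mulNr.
by rewrite [X in - X]mulrC mulrA [X in - X]mulrAC addNr.
Qed.

(** Cover's recursion for [p] points in dimension [d]: without points there is one empty dichotomy,
    and in dimension 0 no point can be strictly labelled. *)
Fixpoint dichotomy_number p d :=
  if p isn't p'.+1 then 1%N else
  if d isn't d'.+1 then 0%N else
  (dichotomy_number p' d'.+1 + dichotomy_number p' d')%N.

(** Pascal's rule solves the recursion; the factor 2 comes from the two labels of a single point. *)
Lemma dichotomy_numberE p d :
  dichotomy_number p.+1 d = (2 * \sum_(0 <= j < d) 'C(p, j))%N.
Proof.
elim: p d => [|p IHp] [|d]; try by rewrite big_geq.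
  by rewrite big_nat_recl // big1_seq // => i; rewrite bin0n.
have -> : dichotomy_number p.+2 d.+1 =
  (dichotomy_number p.+1 d.+1 + dichotomy_number p.+1 d)%N by [].
rewrite !IHp -mulnDr; congr muln.
rewrite [in RHS]big_nat_recl // [in LHS]big_nat_recl // !bin0 -addnA -big_split.
by congr addn; apply: eq_bigr => i _ /=; rewrite binS.
Qed.

Lemma sum_subsetU1 (F : {set T} -> nat) a S : a \notin S ->
  (\sum_(A : {set T} | A \subset a |: S) F A =
   \sum_(A : {set T} | A \subset S) (F A + F (a |: A)))%N.
Proof.
move=> aS; rewrite (bigID (fun A : {set T} => a \in A)) /= addnC big_split /=.
congr addn.
  by apply: eq_bigl => A; rewrite -subsetD1 setU1K.
rewrite (reindex_onto (fun A => a |: A) (fun A => A :\ a)) /=; last first.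
  by move=> A /andP[_ aA]; rewrite setD1K.
apply: eq_bigl => A; rewrite setU11 andbT.
apply/andP/idP => [[sAS /eqP <-]|sAS].
  by rewrite -(setU1K aS) setSD.
have aA : a \notin A by apply: contra aS; apply: (subsetP sAS).
by rewrite setUS // setU1K.
Qed.

(** Induction on the number of points: after removal of [a], the dichotomies of the rest are counted
    once on [U] and once more on the hyperplane of [U] where [phi a] vanishes. *)
Lemma cover_count U S : in_general_position U S ->
  (\sum_(A : {set T} | A \subset S) `[< separable U S A >] =
   dichotomy_number #|S| (\dim U))%N.
Proof.
move cardS: #|S| => p gpU; elim: p => [|p IHp] in U S cardS gpU *.
  move/eqP: cardS; rewrite cards_eq0 => /eqP ->.
  rewrite (big_pred1 set0) => [|A]; last by rewrite subset0.
  suff -> : `[< separable U set0 set0 >] by [].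
  by apply/asboolP; exists 0; [exact: mem0v | move=> i; rewrite inE].
have /card_gt0P[a aS] : (0 < #|S|)%N by rewrite cardS.
case: (posnP (\dim U)) => [U0|U_gt0].
  rewrite U0 big1 // => A _; apply/eqP; rewrite eqb0; apply/asboolP => -[w wU].
  move/(_ a aS); move/eqP: U0 wU; rewrite dimv_eq0 => /eqP ->.
  by rewrite memv0 => /eqP->; rewrite linear0 mulr0 ltxx.
have [u uU phi_u] := general_position_exists gpU aS U_gt0.
have cardS' : #|S :\ a| = p.
  by apply: succn_inj; rewrite -cardS [in RHS](cardsD1 a) aS.
have aS' : a \notin S :\ a by rewrite setD11.
rewrite -(setD1K aS) in gpU *; rewrite sum_subsetU1 //.
under eq_bigr => A AS do rewrite (separable_extensions aS' AS uU phi_u).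
(* Writing [\dim U] as a successor unfolds one step of the recursion; the last rewrite restores
   [\dim U] where it survives. *)
rewrite big_split /= -(dim_cap_lker uU phi_u) /= (dim_cap_lker uU phi_u).
rewrite !IHp //; first exact: general_position_cap gpU uU phi_u.
by move=> J JS; apply: gpU; apply: subset_trans JS (subsetUr _ _).
Qed.
End Cover.

(** * Cyclic shifts of indices and windows *)

Lemma iter_ord_pred_inj m s : injective (iter s (@ord_pred m)).
Proof. by elim: s => [|s IHs] // i j /= /(can_inj (@ord_predK m))/IHs. Qed.

(** Going back [i] steps reaches 0, and [m - j] further steps reach [j] modulo [m]. *)
Lemma iter_ord_pred_trans m (i j : 'I_m) :
  iter (i + (m - j)) (@ord_pred m) i = j.
Proof.
apply/val_inj => /=; set x := iter _ _ _.
rewrite -[LHS](modn_small (ltn_ord _)) -[RHS](modn_small (ltn_ord j)).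
apply/eqP; rewrite -(eqn_modDr (i + (m - j))) iter_ord_predE.
by rewrite addnCA subnKC ?modnDr // ltnW.
Qed.

Lemma iter_ord_pred_div k W s (i' : 'I_W) (i : 'I_(W %/ k)) :
    (k %| W)%N -> (i' %/ k = i)%N ->
  (iter (s * k) (@ord_pred W) i' %/ k = iter s (@ord_pred (W %/ k)) i)%N.
Proof.
move=> kW i'k; have m_gt0 := leq_ltn_trans (leq0n _) (ltn_ord i).
have k_gt0 : (0 < k)%N by case: (k) m_gt0; rewrite ?divn0.
have lt_div (j : 'I_W) : (j %/ k < W %/ k)%N by rewrite ltn_divLR // divnK.
rewrite -[LHS](modn_small (lt_div _)) -[RHS](modn_small (ltn_ord _)).
apply/eqP; rewrite -(eqn_modDr s) iter_ord_predE -i'k -divnDMl //.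
by rewrite !modn_divl divnK // iter_ord_predE.
Qed.

Lemma window_div k i i' : (0 < k)%N ->
  (i * k <= i' < i.+1 * k)%N = (i' %/ k == i)%N.
Proof.
move=> k_gt0; rewrite -leq_divRL // -ltn_divLR // ltnS eqn_leq.
by rewrite andbC.
Qed.

(** A nonzero head coefficient would put its vector in the span of the others. *)
Lemma free_comb_eq0 (K : fieldType) (V : vectType K) (T : eqType) (v : T -> V)
    (s : seq T) (x : T -> K) :
  free (map v s) -> \sum_(i <- s) x i *: v i = 0 -> {in s, forall j, x j = 0}.
Proof.
elim: s => [|i s IHs] //=; rewrite free_cons big_cons => /andP[v_i free_s] sum0.
have x_i : x i = 0.
  apply: contraNeq v_i => x_i; rewrite -(scale1r (v i)) -(mulVf x_i) -scalerA.
  move/eqP: sum0; rewrite addr_eq0 => /eqP ->; rewrite memvZ // memvN.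
  rewrite big_seq memv_suml // => j js.
  by rewrite memvZ // memv_span // map_f.
move=> j /[1!inE] /predU1P[-> //|]; apply: (IHs free_s).
by move: sum0; rewrite x_i scale0r add0r.
Qed.

(** * Channel sums, pooling and shifts *)

Section Pooling.
Variables (R : realType) (N : nat).
Local Notation fm m n := (fmaps R N m n).

Definition total m n (a : fm m n) (c : 'I_N) : R := \sum_i \sum_j a c i j.

(** Row vectors will parametrise the range of the averaging operator, which yields its dimension
    [N]. *)
Definition const_fmap m n (x : 'rV[R]_N) : fm m n :=
  [ffun c => const_mx (x 0 c)].

Fact const_fmap_is_linear m n : linear (@const_fmap m n).
Proof.
by move=> x a b; apply/ffunP=> c; apply/matrixP=> i j; rewrite !(ffunE, mxE).
Qed.

HB.instance Definition _ m n := GRing.isLinear.Build R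
  'rV[R]_N (fm m n) *:%R (@const_fmap m n) (@const_fmap_is_linear m n).

Fact inner_is_linear m n (w : fm m n) :
  linear (inner w : fm m n -> R^o).
Proof.
move=> x a b; rewrite /inner scaler_sumr -big_split; apply: eq_bigr => c _ /=.
rewrite scaler_sumr -big_split; apply: eq_bigr => i _ /=.
rewrite scaler_sumr -big_split; apply: eq_bigr => j _ /=.
by rewrite !(ffunE, mxE) mulrDr mulrCA.
Qed.

HB.instance Definition _ m n (w : fm m n) := GRing.isLinear.Build R
  (fm m n) R^o *:%R (inner w : fm m n -> R^o) (inner_is_linear w).

Lemma innerC m n (a b : fm m n) : inner a b = inner b a.
Proof.
by do 3!(apply: eq_bigr => ? _); rewrite mulrC.
Qed.

Lemma inner_eq0 m n (a : fm m n) : inner a a = 0 -> a = 0.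
Proof.
have a_ge0 c i j : 0 <= a c i j * a c i j by rewrite -expr2 sqr_ge0.
move=> /eqP; rewrite psumr_eq0 => [|c _]; last by do 2!apply: sumr_ge0 => ? _.
move=> /allP a0; apply/ffunP=> c; apply/matrixP=> i j; rewrite ffunE mxE.
have := a0 c; rewrite mem_index_enum psumr_eq0 => [/(_ isT)/allP|i' _].
  move/(_ i); rewrite mem_index_enum psumr_eq0 // => /(_ isT)/allP/(_ j).
  by rewrite mem_index_enum mulf_eq0 orbb => /(_ isT)/eqP.
exact: sumr_ge0.
Qed.

Lemma inner_const_fmap m n (x : 'rV[R]_N) (a : fm m n) :
  inner (const_fmap m n x) a = \sum_c x 0 c * total a c.
Proof.
apply: eq_bigr => c _; rewrite mulr_sumr; apply: eq_bigr => i _.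
by rewrite mulr_sumr; apply: eq_bigr => j _; rewrite ffunE mxE.
Qed.

Lemma total_const_fmap m n (x : 'rV[R]_N) c :
  total (const_fmap m n x) c = (m * n)%:R * x 0 c.
Proof.
rewrite /total mulr_natl mulnC mulrnA -[X in _ *+ X]card_ord -sumr_const.
apply: eq_bigr => i _; rewrite -[X in _ *+ X]card_ord -sumr_const.
by apply: eq_bigr => j _; rewrite ffunE mxE.
Qed.

Lemma total_cshift m n s t (a : fm m n) c :
  total (cshift R N m n s t a) c = total a c.
Proof.
rewrite lfunE /= [RHS](reindex_inj (@iter_ord_pred_inj m s)).
apply: eq_bigr => i _; rewrite [RHS](reindex_inj (@iter_ord_pred_inj n t)).
by apply: eq_bigr => j _; rewrite ffunE mxE.
Qed.

Lemma sum_windows k W (F : 'I_W -> R) : (0 < k)%N -> (k %| W)%N ->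
  \sum_(i < W %/ k) \sum_(i' < W | (i * k <= i' < i.+1 * k)%N) F i' =
  \sum_i F i.
Proof.
move=> k_gt0 kW.
have lt_div (j : 'I_W) : (j %/ k < W %/ k)%N by rewrite ltn_divLR // divnK.
rewrite [RHS](partition_big (fun i => Ordinal (lt_div i)) xpredT) //=.
by apply: eq_bigr => i _; apply: eq_bigl => i'; rewrite window_div.
Qed.

(** The windows tile both axes, so every entry is counted exactly once. *)
Lemma total_pool k W L (a : fm W L) c : (0 < k)%N -> (k %| W)%N -> (k %| L)%N ->
  total (pool R N k W L a) c = (k%:R ^+ 2)^-1 * total a c.
Proof.
move=> k_gt0 kW kL; rewrite lfunE /= /total -(sum_windows _ k_gt0 kW) mulr_sumr.
apply: eq_bigr => i _; rewrite exchange_big /=.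
rewrite -(sum_windows _ k_gt0 kL) mulr_sumr.
by apply: eq_bigr => j _; rewrite ffunE mxE exchange_big.
Qed.

Lemma sum_window_shift k W s (i : 'I_(W %/ k)) (F : 'I_W -> R) :
    (0 < k)%N -> (k %| W)%N ->
  \sum_(i' < W | (i * k <= i' < i.+1 * k)%N) F (iter (s * k) (@ord_pred W) i') =
  \sum_(i' < W | (iter s (@ord_pred (W %/ k)) i * k <= i' <
                    (iter s (@ord_pred (W %/ k)) i).+1 * k)%N) F i'.
Proof.
move=> k_gt0 kW; rewrite [RHS](reindex_inj (@iter_ord_pred_inj W (s * k))).
apply: eq_bigl => i'; rewrite !window_div //.
have lt_div : (i' %/ k < W %/ k)%N by rewrite ltn_divLR // divnK.
rewrite (@iter_ord_pred_div k W s i' (Ordinal lt_div)) //.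
by rewrite val_eqE (inj_eq (@iter_ord_pred_inj _ s)).
Qed.

(** Equivariance of pooling: a shift by whole windows permutes the windows. It lets shifts after
    pooling be read as shifts of the input. *)
Lemma pool_cshift k W L s t (a : fm W L) :
    (0 < k)%N -> (k %| W)%N -> (k %| L)%N ->
  pool R N k W L (cshift R N W L (s * k) (t * k) a) =
  cshift R N (W %/ k) (L %/ k) s t (pool R N k W L a).
Proof.
move=> k_gt0 kW kL; rewrite !lfunE /=; apply/ffunP=> c; apply/matrixP=> i j.
rewrite !(ffunE, mxE); congr (_ * _); rewrite -sum_window_shift //.
apply: eq_bigr => i' _; rewrite -sum_window_shift //.
by apply: eq_bigr => j' _; rewrite !(ffunE, mxE).
Qed.

Lemma cshift_const_fmap m n s t x :
  cshift R N m n s t (const_fmap m n x) = const_fmap m n x.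
Proof.
by rewrite lfunE; apply/ffunP=> c; apply/matrixP=> i j; rewrite !(ffunE, mxE).
Qed.

Lemma cshift_invariant m n (a : fm m n) : (0 < m)%N -> (0 < n)%N ->
  (forall s t, cshift R N m n s t a = a) -> exists x, a = const_fmap m n x.
Proof.
case: m n a => [|m] [|n] // a _ _ inv_a; exists (\row_c a c 0 0).
apply/ffunP=> c; apply/matrixP=> i j; rewrite !(ffunE, mxE).
(* The chosen shift carries the entry at the origin to [(i, j)]. *)
rewrite -[in LHS](inv_a (i + (m.+1 - 0))%N (j + (n.+1 - 0))%N) lfunE /=.
by rewrite !(ffunE, mxE) !(iter_ord_pred_trans _ 0).
Qed.

(** * The averaging operator and its range *)

Section Average.
Variables (W L k : nat).
Hypotheses (W_gt0 : (0 < W)%N) (L_gt0 : (0 < L)%N) (k_gt0 : (0 < k)%N).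
Hypotheses (kW : (k %| W)%N) (kL : (k %| L)%N).
Let m := (W %/ k)%N.
Let n := (L %/ k)%N.
Let m_gt0 : (0 < m)%N. Proof. by rewrite divn_gt0 // dvdn_leq. Qed.
Let n_gt0 : (0 < n)%N. Proof. by rewrite divn_gt0 // dvdn_leq. Qed.

Lemma card_subH_neq0 : #|subH k W L|%:R != 0 :> R.
Proof.
rewrite pnatr_eq0 -lt0n; apply/card_gt0P; exists (0 *+ k).
exact: imset_f.
Qed.

Lemma piG_mulrn (g : torus W L) :
  piG R N (g *+ k) = cshift R N W L (g.1 * k) (g.2 * k).
Proof.
have aux p (x : cyc p) : (0 < p)%N -> (x *+ k)%R = (x * k)%N %[mod p].
  by case: p x => // p x _; rewrite Zp_mulrn /= modn_mod.
by rewrite /piG pairMnE; apply: eq_cshift; apply: aux.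
Qed.

Lemma avg_rhoHE a : avg_rhoH R N k W L a =
  #|subH k W L|%:R^-1 *: \sum_(h in subH k W L) rhoH R N k h a.
Proof. by rewrite scale_lfunE sum_lfunE. Qed.

Lemma avg_rhoH_const x :
  avg_rhoH R N k W L (const_fmap m n x) = const_fmap m n x.
Proof.
rewrite avg_rhoHE (eq_bigr (fun=> const_fmap m n x)) => [|h _].
  by rewrite sumr_const -scaler_nat scalerA mulVf ?card_subH_neq0 // scale1r.
exact: cshift_const_fmap.
Qed.

(** Translation by [g *+ k] permutes the subgroup, so a further shift only reorders the sum. *)
Lemma cshift_avg_rhoH s t a :
  cshift R N m n s t (avg_rhoH R N k W L a) = avg_rhoH R N k W L a.
Proof.
have mW : (m %| W)%N by rewrite dvdn_div.
have nL : (n %| L)%N by rewrite dvdn_div.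
(* Reducing [s] and [t] modulo [W] and [L] leaves the pooled shift unchanged, because [m] divides
   [W] and [n] divides [L]. *)
pose g : torus W L := (inZp s, inZp t).
have cshiftE : cshift R N m n s t = cshift R N m n g.1 g.2.
  by apply: eq_cshift; rewrite /= prednK // modn_dvdm.
rewrite !avg_rhoHE linearZ linear_sum; congr (_ *: _).
rewrite [RHS](reindex_inj (addrI (g *+ k))) /=.
apply: eq_big => [h|_ /imsetP[h _ ->]].
  apply/imsetP/imsetP => -[h' _ hE].
    by exists (h' + g); rewrite // mulrnDl addrC -hE.
  by exists (h' - g); rewrite // mulrnBl -hE addrC addKr.
rewrite -mulrnDl !rhoHE // cshiftE -comp_lfunE -cshiftD.
congr (fun_of_lfun _ _).
have aux p d (x y : cyc p) : (0 < p)%N -> (d %| p)%N ->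
    (x + y = (x + y)%R %[mod d])%N.
  by case: p x y => // p x y _ dp; rewrite /= modn_dvdm.
by apply: eq_cshift; apply: aux.
Qed.

(** Averages are invariant under all shifts, hence constant on each channel; conversely, averaging
    fixes the constants. *)
Lemma limg_avg_rhoH :
  limg (avg_rhoH R N k W L) = limg (linfun (const_fmap m n)).
Proof.
apply/eqP; rewrite eqEsubv; apply/andP; split;
  apply/subvP=> _ /memv_imgP[a _ ->].
  have inv_avg s t := cshift_avg_rhoH s t a.
  have [x ->] := cshift_invariant m_gt0 n_gt0 inv_avg.
  by rewrite -[const_fmap _ _ _]lfunE memv_img ?memvf.
by rewrite lfunE /= -avg_rhoH_const memv_img ?memvf.
Qed.

Lemma dim_limg_avg_rhoH : \dim (limg (avg_rhoH R N k W L)) = N.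
Proof.
rewrite limg_avg_rhoH limg_dim_eq ?dimvf ?dim_matrix; first exact: mul1n.
apply/eqP; rewrite -subv0; apply/subvP=> x.
rewrite memv_cap memvf memv_ker memv0 lfunE /=.
move=> /eqP/ffunP x0; apply/eqP/rowP=> c.
by have /matrixP/(_ (Ordinal m_gt0) (Ordinal n_gt0))  := x0 c;
  rewrite !(ffunE, mxE).
Qed.

(** * Separability after pooling and in the averaged range *)

Section Separability.
Variables (P : nat) (r : 'I_P -> fm W L).
Let A := avg_rhoH R N k W L.
Let v mu := A (pool R N k W L (r mu)).

Lemma limg_avgP u : reflect (exists x, u = const_fmap m n x) (u \in limg A).
Proof.
rewrite limg_avg_rhoH; apply: (iffP memv_imgP) => [[x _ ->]|[x ->]].
  by exists x; rewrite lfunE.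
by exists x; rewrite ?memvf // lfunE.
Qed.

Lemma inner_const_avg x a :
  inner (const_fmap m n x) (A a) = inner (const_fmap m n x) a.
Proof.
rewrite /A avg_rhoHE linearZ linear_sum /=.
rewrite (eq_bigr (fun=> inner (const_fmap m n x) a)).
  rewrite sumr_const -[X in _ *: X]mulr_natl [LHS]mulrA mulVf ?mul1r //.
  exact: card_subH_neq0.
move=> h _; rewrite !inner_const_fmap.
by apply: eq_bigr => c _; rewrite total_cshift.
Qed.

Lemma inner_const_pool_piG x g a :
  inner (const_fmap m n x) (pool R N k W L (piG R N g a)) =
  inner (const_fmap m n x) (pool R N k W L a).
Proof.
rewrite !inner_const_fmap; apply: eq_bigr => c _.
by rewrite !total_pool // total_cshift.
Qed.

(** The coordinates of the orthogonal projection of [w] onto the constant feature maps. *)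
Definition chan_mean (w : fm m n) : 'rV[R]_N :=
  \row_c ((m * n)%:R^-1 * total w c).

Lemma inner_chan_mean w x :
  inner (const_fmap m n (chan_mean w)) (const_fmap m n x) =
  inner w (const_fmap m n x).
Proof.
have mn0 : (m * n)%:R != 0 :> R by rewrite pnatr_eq0 -lt0n muln_gt0 m_gt0.
rewrite [RHS]innerC !inner_const_fmap; apply: eq_bigr => c _.
by rewrite mxE total_const_fmap mulrACA mulVf // mul1r mulrC.
Qed.

(** From left to right, [w] is projected onto the constants and the inequalities for shifts by
    multiples of [k] are averaged. From right to left, a constant [w] sees only channel sums, so one
    inequality serves all [g]. *)
Lemma pool_separableE (y : {ffun 'I_P -> bool}) : pool_separable k r y <->
  separable (fun mu => linfun (inner (v mu) : fm m n -> R^o)) (limg A)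
    [set: 'I_P] [set mu | y mu].
Proof.
split=> [[w w_sep]|[_ /limg_avgP[x ->] w_sep]].
  exists (const_fmap m n (chan_mean w)).
    by apply/limg_avgP; exists (chan_mean w).
  move=> mu _; rewrite inE lfunE /= innerC.
  have /limg_avgP[x vE] : v mu \in limg A by rewrite memv_img ?memvf.
  rewrite vE inner_chan_mean -vE /v /A avg_rhoHE linearZ linear_sum /=.
  rewrite [X in _ * X]/(_ * _) mulrCA mulr_sumr mulr_gt0 //.
    by rewrite invr_gt0 lt0r card_subH_neq0 ler0n.
  have gt0 h : h \in subH k W L ->
      0 < (-1) ^+ y mu * inner w (rhoH R N k h (pool R N k W L (r mu))).
    by case/imsetP=> g _ ->; rewrite rhoHE // -pool_cshift // -piG_mulrn.
  (* The identity of the subgroup supplies a strictly positive term; the other terms need only be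
     nonnegative. *)
  have H0 : 0 \in subH k W L by apply/imsetP; exists 0; rewrite ?mul0rn.
  rewrite (bigD1 _ H0) //= ltr_pwDl ?gt0 // sumr_ge0 // => h /andP[hH _].
  by rewrite ltW ?gt0.
exists (const_fmap m n x) => g mu.
rewrite inner_const_pool_piG -inner_const_avg innerC.
by have := w_sep mu (in_setT _); rewrite inE lfunE.
Qed.

(** A combination of the points lies in the range, so it can serve as its own test vector: being
    orthogonal to itself, it is zero. *)
Lemma general_position_pool : general_position (limg A) v ->
  in_general_position (fun mu => linfun (inner (v mu) : fm m n -> R^o)) (limg A)
    [set: 'I_P].
Proof.
move=> [v_in v_free] J _ /v_free freeJ x x0 mu muJ.
have comb0 : \sum_(i in J) x i *: v i = 0.
  apply: inner_eq0; set u := \sum_(i in J) _; rewrite {2}/u linear_sum /=.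
  have uU : u \in limg A by apply: memv_suml => i _; rewrite memvZ.
  rewrite -[RHS](x0 u uU); apply: eq_bigr => i _.
  by rewrite linearZ lfunE /= innerC.
by apply: (free_comb_eq0 freeJ); rewrite ?big_enum ?mem_enum.
Qed.
End Separability.
End Average.
End Pooling.

(** * From subsets to sign vectors, and the resulting fraction *)

Lemma card_dichotomies (P : nat) (Q : {set 'I_P} -> bool) :
  #|[set y : {ffun 'I_P -> bool} | Q [set mu | y mu]]| =
  (\sum_(A : {set 'I_P} | A \subset [set: 'I_P]) Q A)%N.
Proof.
rewrite cardsE -sum1_card big_mkcond /=.
pose to_fun (A : {set 'I_P}) : {ffun 'I_P -> bool} := [ffun mu => mu \in A].
have to_funK : cancel to_fun (fun y : {ffun 'I_P -> bool} => [set mu | y mu]).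
  by move=> A; apply/setP=> mu; rewrite inE ffunE.
rewrite (reindex to_fun) /=; last first.
  exists (fun y : {ffun 'I_P -> bool} => [set mu | y mu]) => [A _|y _].
    exact: to_funK.
  by apply/ffunP=> mu; rewrite ffunE inE.
apply: eq_big => [A|A _]; first by rewrite subsetT.
by rewrite unfold_in to_funK; case: (Q A).
Qed.

Theorem theorem2 (R : realType) (N W L k P : nat)
    (hN : (1 <= N)%N) (hW : (1 <= W)%N) (hL : (1 <= L)%N)
    (hk : (1 <= k)%N) (hP : (1 <= P)%N)
    (hkW : (k %| W)%N) (hkL : (k %| L)%N)
    (r : 'I_P -> fmaps R N W L)
    (hr : general_position (limg (avg_rhoH R N k W L))
            (fun mu => avg_rhoH R N k W L (pool R N k W L (r mu)))) :
  fraction_pool_separable k r = cover_f R P N.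
Proof.
have count := cover_count (general_position_pool hr).
rewrite cardsT card_ord (dim_limg_avg_rhoH R N hW hL hk hkW hkL) in count.
rewrite /fraction_pool_separable.
under eq_finset => y do
  rewrite (asbool_equiv_eq (pool_separableE hW hL hk hkW hkL r y)).
rewrite (card_dichotomies (fun A => `[< separable _ _ _ A >])) count.
(* With [P = p.+1] the closed form applies; its factor 2 cancels one factor of [2 ^+ p.+1], which
   leaves [2 ^ (1 - P)]. *)
case: P hP {r hr count} => // p _.
rewrite dichotomy_numberE /cover_f subn1 /= natrM natr_sum.
have -> : 1 - (p.+1)%:Z = - p%:Z :> int by rewrite intS; ring.
by rewrite -exprnN exprS invfM; field; rewrite expf_neq0 // pnatr_eq0.
Qed.
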